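(* Let $d \ge 0$ be an integer. Let $A_1, \dots, A_{d+1}$ be an open cover of $\Delta_d$ and let $\alpha_1, \dots, \alpha_{d+1} \colon \Delta_d \to [0,1]$ be a partition of unity subordinate to the cover $\{A_1, \dots, A_{d+1}\}$. Let $\alpha = (\alpha_1, \dots, \alpha_{d+1}) \colon \Delta_d \to \Delta_d$. Then $\alpha$ has a Radon partition or $\bigcap_{i=1}^{d+1} A_i \ne \emptyset$.
   Context: $[n] = \{1,\dots,n\}$. $\Delta_d = \{x \in \mathbb{R}^{d+1} : \sum_i x_i = 1,\ x_i \ge 0 \text{ for all } i \in [d+1]\}$. For $J \subseteq [d+1]$, $\Delta_d^J = \{x \in \Delta_d : x_j = 0 \text{ for all } j \notin J\}$. For a map $f \colon \Delta_d \to \mathbb{R}^n$, a Radon partition for $f$ is a partition $J \sqcup J'$ of $[d+1]$ with $f(\Delta_d^J) \cap f(\Delta_d^{J'}) \ne \emptyset$. A partition of unity is a finite sequence of continuous maps $\alpha_1, \dots, \alpha_n \colon \Delta_d \to [0,1]$ with $\sum_i \alpha_i(x) = 1$ for all $x \in \Delta_d$. It is subordinate to an open cover $A_1, \dots, A_n$ of $\Delta_d$ (sets open in $\Delta_d$ with union $\Delta_d$) if $\alpha_i(x) > 0$ implies $x \in A_i$ for every $i$. *)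

(* Defs.v *)
From HB Require Import structures.
From mathcomp Require Import all_boot all_order all_algebra.
From mathcomp Require Import all_classical all_reals all_analysis.

Set Implicit Arguments.
Unset Strict Implicit.
Unset Printing Implicit Defensive.

Import Order.TTheory GRing.Theory Num.Theory.
Import numFieldNormedType.Exports.

Local Open Scope classical_set_scope.
Local Open Scope ring_scope.

(* Coordinates are indexed by 'I_d.+1 = {0, ..., d} instead of {1, ..., d+1}. *)
Definition simplex (R : realType) (d : nat) : set 'rV[R]_d.+1 :=
  [set x | \sum_i x ord0 i = 1 /\ forall i, 0 <= x ord0 i].
Arguments simplex : clear implicits.

Definition face (R : realType) (d : nat) (J : {set 'I_d.+1}) :
    set 'rV[R]_d.+1 :=
  [set x | simplex R d x /\ forall j, j \notin J -> x ord0 j = 0].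
Arguments face R {d} J _.

(* Maps out of the simplex are total functions on the ambient space; only their
   values on the simplex matter.  A part of the partition may be empty, but the
   face of the empty set is empty, so such a partition is never Radon. *)
Definition radon_partition (R : realType) (d n : nat)
    (f : 'rV[R]_d.+1 -> 'rV[R]_n) (J J' : {set 'I_d.+1}) : Prop :=
  [/\ (J :|: J' = [set: 'I_d.+1])%SET,
      [disjoint J & J']%B &
      (f @` face R J) `&` (f @` face R J') !=set0].

Definition has_radon_partition (R : realType) (d n : nat)
    (f : 'rV[R]_d.+1 -> 'rV[R]_n) : Prop :=
  exists J J' : {set 'I_d.+1}, radon_partition f J J'.

(* [subspace] makes every set disjoint from the simplex open, so [open] below
   means relatively open only because the last clause forces each [A i] to be
   contained in the simplex. *)
Definition simplex_open_cover (R : realType) (d n : nat)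
    (A : 'I_n -> set 'rV[R]_d.+1) : Prop :=
  (forall i, open (A i : set (subspace (simplex R d)))) /\
  \bigcup_i A i = simplex R d.

Definition partition_of_unity (R : realType) (d n : nat)
    (alpha : 'I_n -> 'rV[R]_d.+1 -> R) : Prop :=
  [/\ forall i, {within simplex R d, continuous (alpha i)},
      forall i x, simplex R d x -> 0 <= alpha i x <= 1 &
      forall x, simplex R d x -> \sum_i alpha i x = 1].

Definition subordinate (R : realType) (d n : nat)
    (alpha : 'I_n -> 'rV[R]_d.+1 -> R) (A : 'I_n -> set 'rV[R]_d.+1) : Prop :=
  forall i x, simplex R d x -> 0 < alpha i x -> A i x.

Definition tuple_map (R : realType) (d n : nat)
    (alpha : 'I_n -> 'rV[R]_d.+1 -> R) (x : 'rV[R]_d.+1) : 'rV[R]_n :=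
  \row_i alpha i x.

(* Main.v *)
Require Import Defs.
From HB Require Import structures.
From mathcomp Require Import all_boot all_order all_algebra.
From mathcomp Require Import all_classical all_reals all_analysis.
From mathcomp Require Import lra.

(** Write a vector of the l1 unit sphere of R^(d+1) as z = z+ - z-, the
difference of its positive and negative parts.  Their supports are disjoint, so
the normalizations of z+ and z- lie in complementary faces of the simplex.
Extend each coordinate of alpha to H_i(z) = |z+| alpha_i(z+ / |z+|), read as 0
when z+ = 0; this is continuous because alpha is bounded.  The map
G(z) = H(z) - H(-z) is continuous and odd, from a d-dimensional sphere to
R^(d+1).  The Borsuk-Ulam theorem ([borsuk_ulam]), applied to the d differences
G_i - G_d, gives a z at which all coordinates of G take one value c.
- If c > 0, then H_i(z) = c + H_i(-z) > 0 for all i, so every alpha_i is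
  positive at z+ / |z+|, which therefore lies in every A_i.  If c < 0, the same
  holds for -z.
- If c = 0, summing over i and using that the alpha_i add up to 1 gives
  |z+| = |z-|, hence alpha takes equal values at the normalizations of z+ and
  z-: a Radon partition.

Borsuk-Ulam follows from a combinatorial statement of Tucker type ([tucker]): if
the points of the sphere are labelled by d signed indices, oppositely at
antipodal points, then some arbitrarily close points have opposite labels.  If
an odd map g to R^d had no zero, labelling z by an index i with |g_i(z)| bounded
below, signed by g_i(z), would contradict this by uniform continuity.

The combinatorial statement is proved with chains modulo 2.  A chain is a list
of lists of points, and two chains are identified when every predicate holds on
the same number of members modulo 2; no triangulation is ever constructed.
Let S_n be the chain of all facets of the n-dimensional cross-polytope, and let
h_n be the cone with apex e_n over S_n.  Then S_(n+1) = h_n + (- h_n) and the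
boundary of h_n is S_n, also after iterated barycentric subdivision.  Let phi
say that the labels of a simplex, sorted by index, have alternating signs
beginning with the sign of even labels, and let psi be phi for the opposite
sign.  On simplices without opposite labels, the number of facets satisfying
phi has the parity of phi + psi ([coboundary_sorted_alternates]), and the
antipode exchanges phi and psi ([sorted_alternates_opposite]).  Hence
phi(S_(n+1)) = (phi + psi)(h_n) = phi(boundary of h_n) = phi(S_n), which is odd
for every n ([odd_alternating_octahedron]).  A simplex with d+1 vertices whose
sorted signs alternate has d+1 different indices, and there are only d. *)

Set Implicit Arguments.
Unset Strict Implicit.
Unset Printing Implicit Defensive.

Import Order.TTheory GRing.Theory Num.Theory.
Import numFieldNormedType.Exports.

(** * Chains modulo 2 and subdivision *)

(** Evaluating a predicate on F-images of a chain is evaluating the transpose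
of F on the chain; this makes every operation on chains below respect equality
modulo 2. *)
Lemma odd_count_flatten_map (S T : Type) (F : S -> seq T) (phi : pred T)
    (r : seq S) :
  odd (count phi (flatten (map F r))) =
  odd (count (fun x => odd (count phi (F x))) r).
Proof. by elim: r => //= x r IH; rewrite count_cat !oddD IH oddb. Qed.

Lemma odd_count_addb (S : Type) (p q : pred S) (r : seq S) :
  odd (count (fun x => p x (+) q x) r) = odd (count p r) (+) odd (count q r).
Proof. by elim: r => //= x r IH; rewrite !oddD IH !oddb addbACA. Qed.

Section Chains.
Variable T : Type.
Implicit Types (s t : seq T) (c : seq (seq T)) (phi : pred (seq T)).

(** The empty list is kept as the only facet of a one-point list, so that the
boundary is the augmented one. *)
Fixpoint facets s : seq (seq T) :=
  if s is x :: s' then s' :: map (cons x) (facets s') else [::].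

Definition boundary c := flatten (map facets c).

Lemma odd_count_facets_cons phi x s :
  odd (count phi (facets (x :: s))) =
  phi s (+) odd (count (phi \o cons x) (facets s)).
Proof. by rewrite /= oddD oddb count_map. Qed.

(** Removing two points in either order gives the same list, so the facets of
facets cancel in pairs. *)
Lemma odd_count_boundary_facets phi s :
  odd (count phi (boundary (facets s))) = false.
Proof.
rewrite odd_count_flatten_map.
elim: s phi => // x s IH phi; rewrite odd_count_facets_cons.
rewrite (eq_count (a1 := _ \o _) (fun t => odd_count_facets_cons phi x t)).
by rewrite odd_count_addb IH addbF addbb.
Qed.

(** Facets of a cone either omit the apex, giving the base, or keep it, giving
the cone over a facet of the base. *)
Lemma odd_count_boundary_cone phi x c :
  odd (count phi (boundary (map (cons x) c))) =
  odd (count phi c) (+) odd (count (phi \o cons x) (boundary c)).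
Proof.
rewrite !odd_count_flatten_map count_map -odd_count_addb.
by rewrite (eq_count (fun t => odd_count_facets_cons phi x t)).
Qed.

Variable b : seq T -> T.

(** The fuel [n] is the size of [s]: the recursion is on facets, which are not
structurally smaller. *)
Fixpoint subdivide_rec n s :=
  if n is m.+1 then
    map (cons (b s)) (flatten (map (subdivide_rec m) (facets s)))
  else [:: s].

Definition subdivide s := subdivide_rec (size s) s.
Definition subdivision c := flatten (map subdivide c).
End Chains.

Lemma facets_map (S T : Type) (f : S -> T) s :
  facets (map f s) = map (map f) (facets s).
Proof. by elim: s => //= x s ->; rewrite -!map_comp. Qed.

Lemma subseq_facets (T : eqType) (s t : seq T) : t \in facets s -> subseq t s.
Proof.
elim: s t => //= x s IH t; rewrite inE => /orP[/eqP->|/mapP[u us ->]].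
  exact: subseq_cons.
by rewrite /= eqxx IH.
Qed.

Lemma size_facets (T : eqType) (s t : seq T) :
  t \in facets s -> (size t).+1 = size s.
Proof.
elim: s t => //= x s IH t; rewrite inE => /orP[/eqP->//|/mapP[u us ->]].
by rewrite /= IH.
Qed.

Section Subdivision.
Variables (T : eqType) (b : seq T -> T).
Implicit Types (s t : seq T) (c : seq (seq T)) (phi : pred (seq T)).

Lemma subdivide_cons x s : subdivide b (x :: s) =
  map (cons (b (x :: s))) (subdivision b (facets (x :: s))).
Proof.
rewrite -[LHS]/(map _ (flatten (map (subdivide_rec b (size s)) _))).
congr (map _ (flatten _)); by apply/eq_in_map => t /size_facets [<-].
Qed.

Lemma subdivide_ind (P : seq T -> seq T -> Prop) :
  P [::] [::] ->
  (forall x s t u, t \in facets (x :: s) -> u \in subdivide b t -> P t u ->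
     P (x :: s) (b (x :: s) :: u)) ->
  forall s t, t \in subdivide b s -> P s t.
Proof.
move=> P0 PS s; have [n] := ubnP (size s).
elim: n s => // n IH [|x s] lt_n t.
  by rewrite inE => /eqP->.
rewrite subdivide_cons => /mapP[u /flatten_mapP[v vs uv] ->].
by apply: (PS _ _ _ _ vs uv); apply: IH => //; rewrite (size_facets vs).
Qed.

(** Subdivision is a chain map: the boundary of the cone over the subdivided
boundary of [s] is that subdivided boundary plus a cone over its own boundary,
and the latter vanishes because, by induction, it is a subdivided boundary of a
boundary. *)
Lemma boundary_subdivide phi s :
  odd (count phi (boundary (subdivide b s))) =
  odd (count phi (subdivision b (facets s))).
Proof.
have [n] := ubnP (size s); elim: n s phi => // n IH [|x s] phi // lt_n.
rewrite subdivide_cons odd_count_boundary_cone -[RHS]addbF; congr addb.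
set psi := phi \o _; set c := facets _.
transitivity (odd (count psi (subdivision b (boundary c)))).
  rewrite !odd_count_flatten_map; congr odd; apply: eq_in_count => t tc.
  rewrite -odd_count_flatten_map -[LHS]/(odd (count psi (boundary _))).
  rewrite IH; last by rewrite (size_facets tc).
  by rewrite odd_count_flatten_map.
by rewrite odd_count_flatten_map odd_count_boundary_facets.
Qed.

Lemma odd_count_boundary_subdivision phi c :
  odd (count phi (boundary (subdivision b c))) =
  odd (count phi (subdivision b (boundary c))).
Proof.
rewrite !odd_count_flatten_map; congr odd; apply: eq_count => s.
rewrite -odd_count_flatten_map -[LHS]/(odd (count phi (boundary _))).
by rewrite boundary_subdivide odd_count_flatten_map.
Qed.

Lemma subdivision_map f c :
  (forall s, b (map f s) = f (b s)) ->
  subdivision b (map (map f) c) = map (map f) (subdivision b c).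
Proof.
move=> fb; rewrite /subdivision map_flatten -!map_comp; congr flatten.
apply: eq_map => s /=; have [n] := ubnP (size s).
elim: n s => // n IH [|x s] lt_n //.
rewrite [map f _]/= !subdivide_cons -[f x :: _]/(map f (x :: s)) fb facets_map.
rewrite /subdivision -map_comp -[RHS]map_comp.
have -> : map (subdivide b \o map f) (facets (x :: s)) =
    map (map (map f)) (map (subdivide b) (facets (x :: s))).
  rewrite -map_comp; apply/eq_in_map => t /size_facets ts /=.
  by rewrite IH // ts.
by rewrite -map_flatten -map_comp.
Qed.

End Subdivision.

(** For a convex [C] and the barycenter this says that subdividing stays inside
the convex hull. *)
Lemma subdivide_stable (T : eqType) (b : seq T -> T) (C : T -> Prop) :
  (forall x s, (forall y, y \in x :: s -> C y) -> C (b (x :: s))) ->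
  forall s t, t \in subdivide b s -> (forall y, y \in s -> C y) ->
    forall y, y \in t -> C y.
Proof.
move=> Cb; apply: subdivide_ind => // x s t u ts _ IH Cs y.
rewrite inE => /orP[/eqP->|]; first exact: Cb.
by apply: IH => z zt; apply: Cs; exact: mem_subseq (subseq_facets ts) _ zt.
Qed.

Lemma size_subdivide (T : eqType) (b : seq T -> T) (s t : seq T) :
  t \in subdivide b s -> size t = size s.
Proof.
move: s t; apply: subdivide_ind => // x s t u ts _ /= ->.
by rewrite (size_facets ts).
Qed.

(** * Alternating label sequences *)

(** Labels encode signed indices: [x./2] is the index of [x] and its parity the
sign. *)
Fixpoint alternates (p : bool) (l : seq nat) : bool :=
  if l is x :: l' then (odd x == p) && alternates (~~ p) l' else true.

(** The sign alternation of ordered lists is the cup power of the cocycle that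
detects sign changes, multiplied by the indicator of a sign; the coboundary of
that indicator is the cocycle, whence one more factor and no condition left on
the first sign. *)
Lemma coboundary_alternates p l :
  odd (count (alternates p) (facets l)) =
  alternates false l (+) alternates true l.
Proof.
elim: l p => // x l IH p; rewrite odd_count_facets_cons.
have [<-|] := eqVneq (odd x) p.
  rewrite (eq_count (a2 := alternates (~~ odd x))) => [|t /=]; last first.
    by rewrite eqxx.
  by rewrite IH /=; case: (odd x) => /=; do 2!case: alternates.
move=> /negbTE xp.
rewrite (eq_count (a2 := pred0)) => [|t /=]; last by rewrite xp.
rewrite count_pred0 addbF /=.
by case: (odd x) p xp => -[] //= _; rewrite ?addbF ?addFb.
Qed.

Section Labels.
Implicit Types l : seq nat.

Definition opposite x := x./2.*2 + ~~ odd x.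

Lemma half_opposite x : (opposite x)./2 = x./2.
Proof. by rewrite /opposite addnC half_bit_double. Qed.

Lemma odd_opposite x : odd (opposite x) = ~~ odd x.
Proof. by rewrite oddD odd_double oddb. Qed.

Lemma eq_half_odd x y : x./2 = y./2 -> odd x = odd y -> x = y.
Proof. by move=> xy o; rewrite -(odd_double_half x) xy o odd_double_half. Qed.

Definition antipode_free l := {in l &, forall x y, y != opposite x}.

Lemma half_ltn l x y : antipode_free l -> x \in l -> y \in l -> x <= y ->
  x != y -> x./2 < y./2.
Proof.
move=> fl xl yl le_xy ne_xy.
rewrite ltn_neqAle half_leq // andbT; apply: contraNneq (fl x y xl yl) => h.
apply/eqP/eq_half_odd; rewrite ?half_opposite ?odd_opposite //.
suff: odd x != odd y by case: (odd x) (odd y) => -[].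
by apply: contra ne_xy => /eqP o; exact/eqP/eq_half_odd.
Qed.

(** Sorting is what bounds the dimension, in [size_sorted_alternates]: without it
labels of the same index could recur along an alternating list. *)
Definition sorted_alternates p l := alternates p (sort leq l).

Lemma perm_sorted_alternates p l l' :
  perm_eq l l' -> sorted_alternates p l = sorted_alternates p l'.
Proof.
rewrite /sorted_alternates.
by move=> /(perm_sortP leq_total leq_trans anti_leq) ->.
Qed.

(** For predicates that ignore the order, a facet may be described as removing
an element rather than a position, which is visibly permutation invariant. *)
Lemma count_facets_rem (T : eqType) (phi : pred (seq T)) s :
  (forall t u, perm_eq t u -> phi t = phi u) ->
  count phi (facets s) = count (fun x => phi (rem x s)) s.
Proof.
elim: s phi => // x s IH phi phiP; rewrite /= eqxx; congr addn.
rewrite count_map IH => [|t u tu]; last by apply: phiP; rewrite perm_cons.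
apply: eq_in_count => y ys /=; case: eqVneq => [xy|//]; apply: phiP.
by rewrite xy perm_sym perm_to_rem.
Qed.

Lemma perm_count_facets (T : eqType) (phi : pred (seq T)) s s' :
  (forall t u, perm_eq t u -> phi t = phi u) -> perm_eq s s' ->
  count phi (facets s) = count phi (facets s').
Proof.
move=> phiP ss'; rewrite !count_facets_rem // (permP ss').
apply: eq_in_count => x xs'; apply: phiP; rewrite -(perm_cons x).
have xs : x \in s by rewrite (perm_mem ss').
rewrite -(permPl (perm_to_rem xs)) (permPl ss'); exact: perm_to_rem.
Qed.

(** The facets of a sorted list are sorted, so the statement for ordered lists
applies to the sorted labels. *)
Lemma coboundary_sorted_alternates p l :
  odd (count (sorted_alternates p) (facets l)) =
  sorted_alternates false l (+) sorted_alternates true l.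
Proof.
rewrite -(coboundary_alternates p).
rewrite -(perm_count_facets (s := sort leq l)); first last.
- by rewrite perm_sort.
- exact: perm_sorted_alternates.
congr odd; apply: eq_in_count => t /subseq_facets tl.
rewrite /sorted_alternates sorted_sort //; first exact: leq_trans.
exact: subseq_sorted leq_trans _ _ tl (sort_sorted leq_total _).
Qed.

Lemma alternates_opposite p l :
  alternates p (map opposite l) = alternates (~~ p) l.
Proof. by elim: l p => //= x l IH p; rewrite IH odd_opposite eqb_negLR. Qed.

(** Without opposite pairs, distinct labels have distinct indices, so changing
all signs preserves the sorting. *)
Lemma sorted_alternates_opposite p l : antipode_free l ->
  sorted_alternates p (map opposite l) = sorted_alternates (~~ p) l.
Proof.
move=> fl; rewrite /sorted_alternates -alternates_opposite; congr alternates.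
have -> : sort leq (map opposite l) = sort leq (map opposite (sort leq l)).
  apply/(perm_sortP leq_total leq_trans anti_leq)/perm_map.
  by rewrite perm_sym perm_sort.
apply: sorted_sort; first exact: leq_trans.
apply: (homo_sorted_in (P := mem l) (e := leq)); last first.
- exact: sort_sorted leq_total _.
- by apply/allP => x; rewrite mem_sort.
move=> x y xl yl le_xy; have [->//|ne_xy] := eqVneq x y.
have := half_ltn fl xl yl le_xy ne_xy.
rewrite -(half_opposite x) -(half_opposite y) => lt.
by rewrite leqNgt; apply: contraL lt => /ltnW/half_leq; rewrite leqNgt.
Qed.

Lemma alternates_neq p x y l : alternates p [:: x, y & l] -> x != y.
Proof.
move=> /= /and3P[/eqP xp /eqP yp _]; apply/eqP => xy.
by move: yp; rewrite -xy xp; case: (p).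
Qed.

(** Consecutive sorted labels have different signs, hence are distinct, hence
have increasing indices below [d]. *)
Lemma size_sorted_alternates p d l : antipode_free l -> sorted_alternates p l ->
  all (fun x => x < d.*2) l -> size l <= d.
Proof.
move=> fl al ld; rewrite -(size_sort leq) -(size_map half).
rewrite -[d in _ <= d](size_iota 0).
apply: uniq_leq_size.
  apply: (sorted_uniq ltn_trans ltnn).
  have : sorted leq (sort leq l) by exact: sort_sorted leq_total _.
  have : {subset sort leq l <= l} by move=> x; rewrite mem_sort.
  move: al; rewrite /sorted_alternates.
  elim: (sort leq l) p => // x [//|y s] IH p.
  move=> ap sl /= /andP[le_xy ss].
  apply/andP; split.
    apply: (half_ltn fl); rewrite ?sl ?inE ?eqxx ?orbT //.
    exact: alternates_neq ap.
  apply: (IH (~~ p)) => //; first by case/andP: ap.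
  by move=> z zs; apply: sl; rewrite inE zs orbT.
move=> y /mapP[x]; rewrite mem_sort => /(allP ld) xd ->.
by rewrite mem_iota /= add0n ltn_half_double.
Qed.
End Labels.

(** * The subdivided cross-polytope *)

Section Octahedron.
Variables (T : eqType) (opp : T -> T) (vertex : nat -> T).
Hypothesis oppK : involutive opp.

(** The boundary of the cross-polytope as an iterated suspension: each step joins
the previous sphere to a new vertex and to its opposite. *)
Fixpoint octahedron n : seq (seq T) :=
  if n is m.+1 then
    map (cons (vertex m)) (octahedron m) ++
    map (cons (opp (vertex m))) (octahedron m)
  else [:: [::]].

Definition hemisphere n := map (cons (vertex n)) (octahedron n).

Lemma perm_octahedron_opp n :
  perm_eq (map (map opp) (octahedron n)) (octahedron n).
Proof.
elim: n => // n IH; rewrite /= map_cat perm_catC.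
have E x : map (map opp) (map (cons x) (octahedron n)) =
    map (cons (opp x)) (map (map opp) (octahedron n)).
  by rewrite -!map_comp.
by rewrite !E oppK; apply: perm_cat; apply: perm_map.
Qed.

(** The sphere is the union of a hemisphere and its antipode, because the
equator is symmetric. *)
Lemma perm_octahedronS n :
  perm_eq (octahedron n.+1) (hemisphere n ++ map (map opp) (hemisphere n)).
Proof.
have -> : map (map opp) (hemisphere n) =
    map (cons (opp (vertex n))) (map (map opp) (octahedron n)).
  by rewrite -!map_comp.
by rewrite perm_cat2l perm_map // perm_sym perm_octahedron_opp.
Qed.

Lemma boundary_octahedron phi n :
  odd (count phi (boundary (octahedron n))) = false.
Proof.
elim: n phi => // n IH phi.
rewrite /= /boundary map_cat flatten_cat count_cat oddD.
by rewrite !odd_count_boundary_cone !IH !addbF addbb.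
Qed.

Lemma boundary_hemisphere phi n :
  odd (count phi (boundary (hemisphere n))) = odd (count phi (octahedron n)).
Proof. by rewrite odd_count_boundary_cone boundary_octahedron addbF. Qed.

Lemma size_octahedron n s : s \in octahedron n -> size s = n.
Proof.
elim: n s => [|n IH] s; first by rewrite inE => /eqP->.
by rewrite mem_cat => /orP[]/mapP[t /IH <- ->].
Qed.

Variable b : seq T -> T.
Hypothesis b_opp : forall s, b (map opp s) = opp (b s).

Lemma odd_count_iter_subdivision k phi c c' :
  (forall phi, odd (count phi c) = odd (count phi c')) ->
  odd (count phi (iter k (subdivision b) c)) =
  odd (count phi (iter k (subdivision b) c')).
Proof.
by elim: k phi => [|k IH] phi cc' //=; rewrite !odd_count_flatten_map IH.
Qed.

Lemma odd_count_boundary_iter_subdivision k phi c :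
  odd (count phi (boundary (iter k (subdivision b) c))) =
  odd (count phi (iter k (subdivision b) (boundary c))).
Proof.
elim: k phi => //= k IH phi.
rewrite odd_count_boundary_subdivision [LHS]odd_count_flatten_map IH.
by rewrite -odd_count_flatten_map.
Qed.

Lemma iter_subdivision_opp k c :
  iter k (subdivision b) (map (map opp) c) =
  map (map opp) (iter k (subdivision b) c).
Proof. by elim: k => //= k ->; rewrite subdivision_map. Qed.

Lemma subdivision_cat c c' :
  subdivision b (c ++ c') = subdivision b c ++ subdivision b c'.
Proof. by rewrite /subdivision map_cat flatten_cat. Qed.

Lemma iter_subdivision_cat k c c' : iter k (subdivision b) (c ++ c') =
  iter k (subdivision b) c ++ iter k (subdivision b) c'.
Proof. by elim: k => //= k ->; rewrite subdivision_cat. Qed.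

Variables (label : T -> nat) (k : nat).

(** Fan's counting argument, by induction on the dimension: the count over a
sphere is the count over its upper hemisphere of alternations of both kinds,
hence the count over the boundary of that hemisphere, which is the sphere of
one dimension less. *)
Lemma odd_alternating_octahedron n :
  (forall m s, m <= n -> s \in iter k (subdivision b) (octahedron m) ->
     antipode_free (map label s) /\
     {in s, forall x, label (opp x) = opposite (label x)}) ->
  odd (count (fun s => sorted_alternates false (map label s))
             (iter k (subdivision b) (octahedron n))).
Proof.
elim: n => [|n IH] H.
  by rewrite iter_fix.
have split_octahedron phi : odd (count phi (octahedron n.+1)) =
    odd (count phi (hemisphere n ++ map (map opp) (hemisphere n))).
  by rewrite (permP (perm_octahedronS n)).
rewrite (odd_count_iter_subdivision _ _ split_octahedron).
pose D := iter k (subdivision b) (hemisphere n).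
have Dsub s : s \in D -> s \in iter k (subdivision b) (octahedron n.+1).
  rewrite -[octahedron n.+1]/(hemisphere n ++ _) iter_subdivision_cat -/D.
  by rewrite mem_cat => ->.
rewrite iter_subdivision_cat iter_subdivision_opp -/D count_cat oddD count_map.
have -> : count (preim (map opp)
    (fun s => sorted_alternates false (map label s))) D =
    count (fun s => sorted_alternates true (map label s)) D.
  apply: eq_in_count => s /Dsub /H[//|fs os] /=.
  rewrite -[RHS](sorted_alternates_opposite false fs) -!map_comp.
  by congr sorted_alternates; apply/eq_in_map => x /os.
rewrite -odd_count_addb.
rewrite -(eq_count (fun s => coboundary_sorted_alternates false (map label s))).
rewrite (eq_count (a2 := fun s =>
  odd (count (sorted_alternates false \o map label) (facets s)))); last first.
  by move=> s; rewrite facets_map count_map.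
rewrite -odd_count_flatten_map -[flatten _]/(boundary D).
rewrite odd_count_boundary_iter_subdivision.
rewrite (odd_count_iter_subdivision _ _ (boundary_hemisphere^~ n)).
by apply: IH => m s le_mn; apply: H; rewrite leqW.
Qed.
End Octahedron.

Local Open Scope classical_set_scope.
Local Open Scope ring_scope.

(** * Barycentric subdivision in normed spaces *)

Section Barycenter.
Context {R : realType} {V : normedModType R}.
Implicit Types (s t : seq V).

Definition barycenter s : V := (size s)%:R^-1 *: \sum_(x <- s) x.

Lemma barycenter_opp s : barycenter (map -%R s) = - barycenter s.
Proof. by rewrite /barycenter size_map big_map sumrN scalerN. Qed.

Lemma barycenterB s p : s != [::] ->
  barycenter s - p = (size s)%:R^-1 *: \sum_(x <- s) (x - p).
Proof.
move=> s0; rewrite big_split /= big_const_seq count_predT iter_addr_0.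
rewrite scalerDr -[- p *+ _]scaler_nat scalerA mulVf ?scale1r //.
by rewrite pnatr_eq0 size_eq0.
Qed.

Lemma norm_barycenterB_le s p r : s != [::] ->
  (forall x, x \in s -> `|x - p| <= r) -> `|barycenter s - p| <= r.
Proof.
move=> s0 sr; have n0 : 0 < (size s)%:R :> R by rewrite ltr0n lt0n size_eq0.
rewrite barycenterB // normrZ ger0_norm ?invr_ge0 ?(ltW n0) //.
rewrite ler_pdivrMl //.
rewrite (le_trans (ler_norm_sum _ _ _)) //.
rewrite (le_trans (y := \sum_(x <- s) r)) //.
  by rewrite big_seq [leRHS]big_seq; apply: ler_sum => x; exact: sr.
by rewrite big_const_seq count_predT iter_addr_0 mulr_natl.
Qed.

(** One of the at most [N.+1] points contributes nothing to the average of the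
distances to [v]. *)
Lemma norm_barycenterB_mem s v N D : (size s <= N.+1)%N -> v \in s ->
  (forall x, x \in s -> `|x - v| <= D) ->
  `|barycenter s - v| <= N%:R / N.+1%:R * D.
Proof.
move=> sN vs sD.
have D0 : 0 <= D by apply: le_trans (sD _ vs).
have s0 : s != [::] by apply: contraTneq vs => ->.
have n0 : 0 < (size s)%:R :> R by rewrite ltr0n lt0n size_eq0.
rewrite barycenterB // normrZ ger0_norm ?invr_ge0 ?(ltW n0) // mulrC.
apply: (@le_trans _ _ ((size s).-1%:R * D / (size s)%:R)).
  rewrite ler_pM2r ?invr_gt0 //.
  rewrite (perm_big _ (perm_to_rem vs)) /= big_cons subrr add0r.
  rewrite (le_trans (ler_norm_sum _ _ _)) //.
  rewrite (le_trans (y := \sum_(x <- rem v s) D)) //.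
    by rewrite big_seq [leRHS]big_seq; apply: ler_sum => x /mem_rem; exact: sD.
  by rewrite big_const_seq count_predT iter_addr_0 size_rem // mulr_natl.
rewrite mulrAC ler_wpM2r //.
case: (size s) sN n0 => [|m] mN n0; first by rewrite ltxx in n0.
rewrite ler_pdivrMr // mulrAC ler_pdivlMr ?ltr0n // -!natrM ler_nat /=.
by rewrite !mulnSr mulnC leq_add2l.
Qed.

(** New edges either lie in the subdivision of a proper face or join the
barycenter to a point of the convex hull; the distance of the latter to the
barycenter is largest at a vertex. *)
Lemma subdivide_mesh N D s t : t \in subdivide barycenter s ->
  (size s <= N.+1)%N -> {in s &, forall x y, `|x - y| <= D} ->
  {in t &, forall x y, `|x - y| <= N%:R / N.+1%:R * D}.
Proof.
move: s t; apply: subdivide_ind => // x s t u ts ut IH sN sD.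
have tsub : {subset t <= x :: s} := mem_subseq (subseq_facets ts).
have D0 : 0 <= D by apply: le_trans (sD x x _ _); rewrite ?inE ?eqxx.
have bu y : y \in u -> `|barycenter (x :: s) - y| <= N%:R / N.+1%:R * D.
  rewrite distrC; move: y.
  apply: (subdivide_stable _ ut) => [z w zw|z zt].
    exact: norm_barycenterB_le.
  rewrite distrC; apply: norm_barycenterB_mem => //; first exact: tsub.
  by move=> y ys; apply: sD => //; exact: tsub.
move=> y z; rewrite !inE => /orP[/eqP->|yu] /orP[/eqP->|zu].
- by rewrite subrr normr0 mulr_ge0 // divr_ge0.
- exact: bu.
- by rewrite distrC; exact: bu.
apply: IH => //; first by rewrite (leq_trans _ sN) // -(size_facets ts).
by move=> v w /tsub vs /tsub ws; exact: sD.
Qed.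
End Barycenter.

Section Sphere.
Variable R : realType.
Implicit Types n : nat.

Definition l1norm n (z : 'rV[R]_n) : R := \sum_i `|z ord0 i|.

(** For a sign vector [e], the facet of the l1 unit sphere in the closed orthant
of [e]. *)
Definition cross_facet n (e : 'I_n -> R) (z : 'rV[R]_n) : Prop :=
  \sum_i e i * z ord0 i = 1 /\ forall i, 0 <= e i * z ord0 i.

Definition sign_vector n (e : 'I_n -> R) : Prop := forall i, `|e i| = 1.

Lemma l1norm_cross_facet n (e : 'I_n -> R) z :
  sign_vector e -> cross_facet e z -> l1norm z = 1.
Proof.
move=> e1 [<- ez]; apply: eq_bigr => i _.
by rewrite -[RHS]ger0_norm // normrM e1 mul1r.
Qed.

Lemma cross_facet_barycenter n (e : 'I_n -> R) x s :
  (forall y, y \in x :: s -> cross_facet e y) ->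
  cross_facet e (barycenter (x :: s)).
Proof.
move=> es; set t := x :: s.
have E i : e i * barycenter t ord0 i =
    (size t)%:R^-1 * \sum_(y <- t) e i * y ord0 i.
  by rewrite mxE summxE mulrCA mulr_sumr.
split=> [|i]; last first.
  rewrite E mulr_ge0 ?invr_ge0 // big_seq sumr_ge0 // => y yt.
  by have [_] := es y yt.
under eq_bigr do rewrite E.
rewrite -mulr_sumr exchange_big big_seq /=.
rewrite (eq_bigr (fun _ => 1)) => [|y yt]; last by have [] := es y yt.
by rewrite -big_seq big_const_seq count_predT iter_addr_0 mulVf // pnatr_eq0.
Qed.

Definition unit_row n (j : nat) : 'rV[R]_n.+1 := delta_mx ord0 (inord j).

(** The orthant is built along the recursion; its sign at an index that has not
occurred is arbitrary because all points vanish there. *)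
Lemma octahedron_cross_facet n m s : (m <= n.+1)%N ->
  s \in octahedron -%R (unit_row n) m ->
  exists2 e : 'I_n.+1 -> R, sign_vector e &
    forall x, x \in s -> cross_facet e x.
Proof.
(* Vanishing beyond the first m coordinates is what lets the induction choose
   the sign of the next one freely. *)
move=> mn sm; suff [e e1 es] : exists2 e : 'I_n.+1 -> R, sign_vector e &
    forall x, x \in s -> cross_facet e x /\
      forall j : 'I_n.+1, (m <= j)%N -> x ord0 j = 0.
  by exists e => // x /es[].
elim: m s mn sm => [|m IH] s mn.
  by rewrite inE => /eqP->; exists (fun=> 1) => // i; rewrite normr1.
rewrite /= mem_cat => sm.
have [a a1 [t tm ->]] : exists2 a : R, `|a| = 1 & exists2 t,
    t \in octahedron -%R (unit_row n) m & s = a *: unit_row n m :: t.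
  case/orP: sm => /mapP[t tm ->]; [exists 1|exists (-1)];
    rewrite ?normrN ?normr1 //;
    by exists t; rewrite ?scale1r ?scaleN1r.
have [e e1 et] := IH t (ltnW mn) tm.
have vm j : (unit_row n m) ord0 j = (j == m :> nat)%:R.
  by rewrite mxE eqxx -val_eqE /= inordK.
have aa : a * a = 1 by rewrite -expr2 -(real_normK (num_real a)) a1 expr1n.
exists (fun j : 'I_n.+1 => if j == m :> nat then a else e j).
  by move=> j; case: ifP.
move=> x; rewrite inE => /orP[/eqP->|/et[[xe1 xe2] x0]]; last first.
  split=> [|j mj]; last by apply: x0; exact: ltnW.
  have E (j : 'I_n.+1) :
      (if j == m :> nat then a else e j) * x ord0 j = e j * x ord0 j.
    by case: eqP => // jm; rewrite x0 ?jm // !mulr0.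
  by split=> [|j]; rewrite ?E //; rewrite -xe1; apply: eq_bigr => j _; exact: E.
have E (j : 'I_n.+1) :
    (if j == m :> nat then a else e j) * (a *: unit_row n m) ord0 j =
    (j == m :> nat)%:R.
  by rewrite mxE vm; case: eqP => jm; rewrite ?mulr1 ?mulr0.
split=> [|j mj]; last by rewrite mxE vm gtn_eqF // mulr0.
split=> [|j]; last by rewrite E.
rewrite (eq_bigr _ (fun j _ => E j)) (bigD1 (Ordinal mn)) //= eqxx.
rewrite big1 ?addr0 // => j.
by rewrite -val_eqE /= => /negbTE ->.
Qed.

Lemma norm_rV_le n (z : 'rV[R]_n) r : 0 <= r ->
  (forall i, `|z ord0 i| <= r) -> `|z| <= r.
Proof.
move=> r0 zr; rewrite -[leLHS]/(mx_norm z) mx_normrE.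
apply: bigmax_le => // -[i j] _ /=.
by rewrite (ord1 i).
Qed.

Lemma norm_le_l1norm n (z : 'rV[R]_n) : `|z| <= l1norm z.
Proof.
apply: norm_rV_le => [|i]; first exact: sumr_ge0.
by rewrite /l1norm (bigD1 i) //= lerDl sumr_ge0.
Qed.

Lemma iter_subdivision_octahedron n m k s : (m <= n.+1)%N ->
  s \in iter k (subdivision barycenter) (octahedron -%R (unit_row n) m) ->
  [/\ size s = m,
      exists2 e : 'I_n.+1 -> R, sign_vector e &
        forall x, x \in s -> cross_facet e x &
      {in s &, forall x y, `|x - y| <= (n%:R / n.+1%:R) ^+ k * 2}].
Proof.
move=> mn; elim: k s => [|k IH] s.
  move=> sm; have [e e1 es] := octahedron_cross_facet mn sm.
  split; [exact: size_octahedron sm|by exists e|move=> x y xs ys].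
  rewrite expr0 mul1r (le_trans (ler_normB _ _)) //.
  by rewrite lerD // (le_trans (norm_le_l1norm _)) //;
    rewrite (l1norm_cross_facet e1) //; exact: es.
rewrite /= => /flatten_mapP[t /IH[tm [e e1 et] td]] st; split.
- by rewrite (size_subdivide st).
- exists e => //; apply: (subdivide_stable _ st) => //.
  exact: cross_facet_barycenter.
- by rewrite exprS -mulrA; apply: subdivide_mesh st _ td; rewrite tm.
Qed.

(** Were there no such pair, every small simplex would have labels without
opposite pairs; a fine enough subdivision of the cross-polytope would then
contain an alternating simplex with [n.+1] labels and only [n] indices. *)
Lemma tucker n (label : 'rV[R]_n.+1 -> nat) eps : 0 < eps ->
  (forall z, l1norm z = 1 -> (label z < n.*2)%N) ->
  (forall z, l1norm z = 1 -> label (- z) = opposite (label z)) ->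
  exists u v, [/\ l1norm u = 1, l1norm v = 1, `|u - v| < eps &
    label v = opposite (label u)].
Proof.
move=> eps0 labn labN; apply: contrapT => noedge.
(* Each subdivision shrinks simplices with at most n.+1 vertices by the factor
   n / n.+1; the edges of the cross-polytope have length at most 2. *)
have [k keps] : exists k, (n%:R / n.+1%:R) ^+ k * 2 < eps :> R.
  have : (fun k => (n%:R / n.+1%:R : R) ^+ k) @ \oo --> (0 : R).
    apply: cvg_expr; rewrite ger0_norm ?divr_ge0 //.
    by rewrite ltr_pdivrMr ?ltr0n // mul1r ltr_nat.
  move=> /cvgrPdist_lt /(_ (eps / 2)); rewrite divr_gt0 // => /(_ isT).
  move=> [k _ /(_ k (leqnn k))] /=.
  rewrite sub0r normrN => h; exists k.
  by rewrite -ltr_pdivlMr //; apply: le_lt_trans h; exact: ler_norm.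
have good m s : (m <= n.+1)%N ->
    s \in iter k (subdivision barycenter) (octahedron -%R (unit_row n) m) ->
    antipode_free (map label s) /\ forall x, x \in s -> l1norm x = 1.
  move=> mn /(iter_subdivision_octahedron mn)[_ [e e1 es] sd].
  have s1 x : x \in s -> l1norm x = 1 by move/es; exact: l1norm_cross_facet.
  split=> // _ _ /mapP[u us ->] /mapP[v vs ->]; apply/eqP => uv.
  apply: noedge; exists u, v; split; rewrite ?s1 //.
  by apply: le_lt_trans keps; exact: sd.
have : odd (count (fun s => sorted_alternates false (map label s))
    (iter k (subdivision barycenter) (octahedron -%R (unit_row n) n.+1))).
  apply: (odd_alternating_octahedron opprK barycenter_opp) => m s mn.
  by move=> /(good _ _ mn)[? s1]; split=> // x xs; apply: labN; exact: s1.
move=> /odd_gt0; rewrite -has_count => /hasP[s sk sa].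
have [sf s1] := good _ _ (leqnn _) sk.
have [ss _ _] := iter_subdivision_octahedron (leqnn _) sk.
have : (size (map label s) <= n)%N.
  apply: size_sorted_alternates sf sa _.
  by apply/allP => _ /mapP[x /s1/labn xn ->].
by rewrite size_map ss ltnn.
Qed.
End Sphere.

(** * The Borsuk-Ulam theorem *)

Section BorsukUlam.
Variable R : realType.

Lemma near_dist_lt (V : normedModType R) (x : V) (e : R) :
  0 < e -> \forall y \near x, `|x - y| < e.
Proof. by move=> e0; exact: ((fcvgrPdist_lt x).1 (@cvg_refl _ (nbhs x))). Qed.

(** The functions of coordinates used below are all Lipschitz, which avoids
working with neighbourhoods of matrices. *)
Lemma continuous_of_lipschitz (U V : normedModType R) (f : U -> V) (c : R) :
  (forall x y, `|f x - f y| <= c * `|x - y|) -> continuous f.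
Proof.
move=> fc x; apply/cvgrPdist_lt => e e0.
have c0 : 0 < `|c| + 1 by rewrite ltr_wpDl.
near=> y; apply: le_lt_trans (fc x y) _.
apply: (@le_lt_trans _ _ ((`|c| + 1) * `|x - y|)).
  by rewrite ler_wpM2r // (le_trans (ler_norm c)) // lerDl.
rewrite -ltr_pdivlMl //; near: y.
by apply: near_dist_lt; rewrite mulr_gt0 ?invr_gt0.
Unshelve. all: by end_near. Qed.

Lemma norm_coord_le n (z : 'rV[R]_n) i : `|z ord0 i| <= `|z|.
Proof.
rewrite -[leRHS]/(mx_norm z) mx_normrE.
by apply/bigmax_geP; right; exists (ord0, i).
Qed.

Lemma norm_sumB_le n (h : R -> R) (z w : 'rV[R]_n) :
  (forall x y, `|h x - h y| <= `|x - y|) ->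
  `|\sum_i h (z ord0 i) - \sum_i h (w ord0 i)| <= n%:R * `|z - w|.
Proof.
move=> hl; rewrite -sumrB (le_trans (ler_norm_sum _ _ _)) //.
rewrite (le_trans (y := \sum_(i < n) `|z - w|)) //; last first.
  by rewrite sumr_const card_ord mulr_natl.
apply: ler_sum => i _; rewrite (le_trans (hl _ _)) //.
by rewrite (le_trans _ (norm_coord_le _ i)) // !mxE.
Qed.

Lemma l1norm_continuous n : continuous (@l1norm R n).
Proof.
apply: (@continuous_of_lipschitz _ _ _ n%:R) => z w.
by apply: norm_sumB_le => x y; exact: ler_dist_dist.
Qed.

Lemma compact_l1sphere n : compact [set z : 'rV[R]_n | l1norm z = 1].
Proof.
apply: bounded_closed_compact.
  exists 1; split; first exact: num_real.
  by move=> M M1 z /= z1; rewrite (le_trans (norm_le_l1norm _)) // z1 ltW.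
rewrite -[X in closed X]/(@l1norm R n @^-1` [set 1]).
by apply: closed_comp; [move=> z _; exact: l1norm_continuous|exact: closed_eq].
Qed.

Lemma compact_nonvanishing (T : topologicalType) n (g : 'I_n -> T -> R)
    (K : set T) :
  compact K -> (forall i, continuous (g i)) ->
  (forall z, K z -> exists i, g i z != 0) ->
  exists2 m : R, 0 < m & forall z, K z -> exists i, m <= `|g i z|.
Proof.
move=> /compact_near_coveringP cK cg gK.
have [m [/= m0 mK]] : exists m : R, 0 < m /\
    K `<=` (fun z => exists i, m <= `|g i z|).
  suff /(filterI (nbhs_right_gt 0)) : \forall m \near 0^'+,
    K `<=` (fun z => exists i, m <= `|g i z|).
    exact: filter_ex.
  apply: cK => z /gK[i gi0].
  have gi2 : 0 < `|g i z| / 2 by rewrite divr_gt0 ?normr_gt0.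
  have gw : \forall w \near z, `|g i z - g i w| < `|g i z| / 2.
    by apply: cvgr_dist_lt => //; exact: cg.
  near=> w m; exists i.
  have zw : `|g i z - g i w| < `|g i z| / 2 by near: w.
  have mz : m < `|g i z| / 2 by near: m; exact: nbhs_right_lt.
  have := lerB_dist (g i z) (g i w); rewrite /=; lra.
by exists m.
Unshelve. all: by end_near. Qed.

(** The Heine-Cantor theorem, for finitely many functions; only one of the two
points needs to be in the compact set. *)
Lemma compact_uniform_modulus (V : normedModType R) n (g : 'I_n -> V -> R)
    (K : set V) m :
  compact K -> (forall i, continuous (g i)) -> 0 < m ->
  exists2 r : R, 0 < r &
    forall u v, K u -> `|u - v| < r -> forall i, `|g i u - g i v| < m.
Proof.
move=> /compact_near_coveringP cK cg m0.
have [r [/= r0 rK]] : exists r : R, 0 < r /\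
    K `<=` (fun u => forall v, `|u - v| < r -> forall i, `|g i u - g i v| < m).
  suff /(filterI (nbhs_right_gt 0)) : \forall r \near 0^'+,
    K `<=` (fun u => forall v, `|u - v| < r -> forall i, `|g i u - g i v| < m).
    exact: filter_ex.
  apply: cK => z Kz.
  have : \forall w \near z, forall i, `|g i z - g i w| < m / 2.
    apply: filter_forall => i.
    by apply: cvgr_dist_lt; [exact: cg|rewrite divr_gt0].
  move=> /nbhs_ballP[e /= e0 ze].
  have e2 : 0 < e / 2 by rewrite divr_gt0.
  near=> u r => v uv i.
  have zu : `|z - u| < e / 2 by near: u; exact: near_dist_lt.
  have re : r < e / 2 by near: r; exact: nbhs_right_lt.
  have zv : `|z - v| < e.
    rewrite (splitr e) -[z](subrK u) -addrA (le_lt_trans (ler_normD _ _)) //.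
    by rewrite ltrD // (lt_trans uv).
  have zu' : `|z - u| < e by lra.
  have h1 : `|g i z - g i u| < m / 2 by apply: ze; rewrite -ball_normE.
  have h2 : `|g i z - g i v| < m / 2 by apply: ze; rewrite -ball_normE.
  rewrite (splitr m) -[g i u](subrK (g i z)) -addrA.
  rewrite (le_lt_trans (ler_normD _ _)) //.
  by rewrite ltrD // distrC.
by exists r => // u v /rK; exact.
Unshelve. all: by end_near. Qed.

(** The label of [z] is an index whose coordinate is at least [m] in absolute
value, with the sign of that coordinate.  Opposite labels at two points force a
jump of at least [2 * m], which uniform continuity forbids for close points. *)
Theorem borsuk_ulam n (g : 'I_n -> 'rV[R]_n.+1 -> R) :
  (forall i, continuous (g i)) -> (forall i z, g i (- z) = - g i z) ->
  exists2 z, l1norm z = 1 & forall i, g i z = 0.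
Proof.
move=> cg gN; apply: contrapT => nozero.
have cK := @compact_l1sphere n.+1.
have [|m m0 gm] := compact_nonvanishing cK cg.
  move=> z z1; apply: contrapT => gz; apply: nozero; exists z => // i.
  by apply: contrapT => /eqP gi; apply: gz; exists i.
have [r r0 gr] := compact_uniform_modulus cK cg m0.
pose label z := if [pick i | m <= `|g i z|] is Some i
  then (i.*2 + (g i z < 0)%R)%N else 0%N.
have labelP z : l1norm z = 1 -> exists i, [/\ m <= `|g i z|,
    label z = (i.*2 + (g i z < 0)%R)%N &
    label (- z) = (i.*2 + (0 < g i z)%R)%N].
  move=> z1; rewrite /label.
  rewrite (eq_pick (Q := fun i => m <= `|g i z|)) => [|i]; last first.
    by rewrite gN normrN.
  case: pickP => [i gi|none]; first by exists i; rewrite gN oppr_lt0.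
  by have [i] := gm z z1; rewrite none.
have := @tucker R n label r r0; case.
- move=> z /labelP[i [_ -> _]]; rewrite -ltn_half_double.
  by rewrite [(_ + _)%N]addnC half_bit_double ltn_ord.
- move=> z /labelP[i [gi -> ->]].
  rewrite /opposite [(i.*2 + (g i z < 0)%R)%N]addnC half_bit_double.
  rewrite oddD odd_double addbF oddb.
  congr (_ + nat_of_bool _)%N.
  have : g i z != 0 by apply: contraTneq gi => ->; rewrite normr0 -ltNge.
  by case: ltgtP.
move=> u [v [u1 v1 uv]].
have [i [gi -> _]] := labelP u u1; have [j [gj -> _]] := labelP v v1.
move=> E; have := congr1 half E; have := congr1 odd E.
rewrite half_opposite odd_opposite !(addnC _.*2) !half_bit_double.
rewrite !oddD !odd_double !addbF !oddb => Es /val_inj ji.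
move: gj Es; rewrite ji => gj Es.
have := gr u v u1 uv i; move: Es gi gj.
by case: (ltrP (g i v) 0) => h1; case: (ltrP (g i u) 0) => h2 //= _;
  rewrite ?(ger0_norm h1) ?(ger0_norm h2) ?(ltr0_norm h1) ?(ltr0_norm h2);
  rewrite ltr_norml; lra.
Qed.
End BorsukUlam.

(** * From the simplex to the sphere *)

(** The rescaling blows up where [m] vanishes, but there [f] is bounded and the
factor [m] makes the product tend to 0. *)
Lemma continuous_scaled_rescale (R : realType) (V W : normedModType R)
    (A : set W) (f : W -> R) (m : V -> R) (p : V -> W) :
  continuous m -> continuous p -> (forall z, 0 <= m z) ->
  (forall z, 0 < m z -> A ((m z)^-1 *: p z)) ->
  {within A, continuous f} -> (forall x, A x -> 0 <= f x <= 1) ->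
  continuous (fun z => m z * f ((m z)^-1 *: p z)).
Proof.
move=> cm cp m_ge0 Amp /subspace_continuousP cf f01 z.
have := m_ge0 z; rewrite le_eqVlt => /orP[/eqP z0|z0].
  rewrite /continuous_at -[X in _ --> X]/(m z * _) -z0 mul0r.
  apply: (squeeze_cvgr (f := fun=> 0) (h := m)); last 2 first.
  - exact: cvg_cst.
  - by rewrite [X in _ --> X]z0; exact: cm.
  apply: nearW => w.
  have := m_ge0 w; rewrite le_eqVlt => /orP[/eqP <-|w0].
    by rewrite mul0r lexx.
  have /andP[f0 f1] := f01 _ (Amp _ w0).
  by rewrite mulr_ge0 ?(ltW w0) //= ler_piMr // ltW.
have cN : (m w)^-1 *: p w @[w --> z] --> (m z)^-1 *: p z.
  apply: cvgZ; last exact: cp.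
  by apply: cvgV; [rewrite gt_eqF|exact: cm].
apply: cvgM; first exact: cm.
apply: (@cvg_comp _ _ _ (fun w => (m w)^-1 *: p w) f _
  (within A (nbhs ((m z)^-1 *: p z)))); last by apply: cf; exact: Amp.
move=> U AU.
have zU : \forall w \near z, A ((m w)^-1 *: p w) -> U ((m w)^-1 *: p w).
  exact: cN AU.
have mz : \forall w \near z, 0 < m w by apply: cvgr_gt z0; exact: cm.
change (\forall w \near z, U ((m w)^-1 *: p w)).
by near=> w; apply: (near zU w) => //; apply: Amp; near: w.
Unshelve. all: by end_near. Qed.

Lemma continuous_odd_part (R : realType) (V : normedModType R) (h : V -> R) :
  continuous h -> continuous (fun z => h z - h (- z)).
Proof.
move=> ch z; apply: cvgB; first exact: ch.
apply: (@cvg_comp _ _ _ -%R h _ (nbhs (- z))); last exact: ch.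
exact: opp_continuous.
Qed.

Lemma continuousB_fun (R : realType) (V : normedModType R) (h k : V -> R) :
  continuous h -> continuous k -> continuous (fun z => h z - k z).
Proof. by move=> ch ck z; apply: cvgB; [exact: ch|exact: ck]. Qed.

Section HomogeneousExtension.
Variables (R : realType) (d : nat).
Implicit Types z w : 'rV[R]_d.+1.

Definition pos_part z : 'rV[R]_d.+1 := \row_i Num.max (z ord0 i) 0.
Definition pos_mass z : R := \sum_i Num.max (z ord0 i) 0.
(** When [z] has no positive coordinate this is the zero vector, which lies
outside the simplex. *)
Definition pos_point z : 'rV[R]_d.+1 := (pos_mass z)^-1 *: pos_part z.

Lemma pos_mass_ge0 z : 0 <= pos_mass z.
Proof. by apply: sumr_ge0 => i _; rewrite le_max lexx orbT. Qed.

Lemma pos_massD z : pos_mass z + pos_mass (- z) = l1norm z.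
Proof.
rewrite -big_split /=; apply: eq_bigr => i _; rewrite mxE.
by case: (lerP (z ord0 i) 0) => z0;
  [rewrite ler0_norm // max_l|rewrite gtr0_norm // max_r];
  rewrite ?oppr_ge0 ?oppr_le0 ?add0r ?addr0 // ltW.
Qed.

Lemma pos_point_simplex z : 0 < pos_mass z -> simplex R d (pos_point z).
Proof.
move=> z0; split=> [|i]; last first.
  by rewrite !mxE mulr_ge0 ?invr_ge0 ?pos_mass_ge0 // le_max lexx orbT.
under eq_bigr do rewrite !mxE.
by rewrite -mulr_sumr mulVf // gt_eqF.
Qed.

Lemma pos_point_face z (J : {set 'I_d.+1}) : 0 < pos_mass z ->
  (forall i, i \notin J -> z ord0 i <= 0) -> face R J (pos_point z).
Proof.
move=> z0 zJ; split=> [|i /zJ zi]; first exact: pos_point_simplex.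
by rewrite !mxE max_r // mulr0.
Qed.

Lemma dist_max0_le (x y : R) : `|Num.max x 0 - Num.max y 0| <= `|x - y|.
Proof.
by case: (lerP x 0) => x0; case: (lerP y 0) => y0;
  rewrite ler_norml; apply/andP; split; have := ler_norm (x - y);
  have := ler_norm (- (x - y)); rewrite normrN; lra.
Qed.

Lemma pos_mass_continuous : continuous pos_mass.
Proof.
apply: (@continuous_of_lipschitz _ _ _ _ d.+1%:R) => z w.
apply: (@norm_sumB_le _ _ (fun x => Num.max x 0)); exact: dist_max0_le.
Qed.

Lemma pos_part_continuous : continuous pos_part.
Proof.
apply: (@continuous_of_lipschitz _ _ _ _ 1) => z w; rewrite mul1r.
apply: norm_rV_le => // i; rewrite !mxE (le_trans (dist_max0_le _ _)) //.
by rewrite (le_trans _ (norm_coord_le _ i)) // !mxE.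
Qed.

Definition homogeneous_extension (f : 'rV[R]_d.+1 -> R) z : R :=
  pos_mass z * f (pos_point z).

Lemma homogeneous_extension_continuous (f : 'rV[R]_d.+1 -> R) :
  {within simplex R d, continuous f} ->
  (forall x, simplex R d x -> 0 <= f x <= 1) ->
  continuous (homogeneous_extension f).
Proof.
move=> cf f01; apply: (continuous_scaled_rescale (A := simplex R d)) => //.
- exact: pos_mass_continuous.
- exact: pos_part_continuous.
- exact: pos_mass_ge0.
- exact: pos_point_simplex.
Qed.
End HomogeneousExtension.

Theorem theorem4p3 (R : realType) (d : nat)
    (A : 'I_d.+1 -> set 'rV[R]_d.+1)
    (alpha : 'I_d.+1 -> 'rV[R]_d.+1 -> R)
    (hA : simplex_open_cover A)
    (halpha : partition_of_unity alpha)
    (hsub : subordinate alpha A) :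
  has_radon_partition (tuple_map alpha) \/ \bigcap_i A i !=set0.
Proof.
have [ca a01 a1] := halpha.
pose H i := homogeneous_extension (alpha i).
have cH i : continuous (H i).
  by apply: homogeneous_extension_continuous; [exact: ca|exact: a01].
pose G i z := H i z - H i (- z).
have cG i : continuous (G i) by exact: continuous_odd_part.
have GN i z : G i (- z) = - G i z by rewrite /G opprK opprB.
have [||z z1 gz] :=
  @borsuk_ulam R d (fun i z => G (lift ord_max i) z - G ord_max z).
- by move=> i; exact: continuousB_fun.
- by move=> i z; rewrite !GN -opprD.
have {gz} Gz i : G i z = G ord_max z.
  case: (unliftP ord_max i) => [j ->|->] //.
  by apply/eqP; rewrite -subr_eq0 gz.
have mass_gt0 w i : 0 < H i w -> 0 < pos_mass w.
  move=> h; rewrite lt_neqAle pos_mass_ge0 andbT; apply: contraTneq h => w0.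
  by rewrite /H /homogeneous_extension -w0 mul0r ltxx.
have common w : (forall i, 0 < H i w) -> \bigcap_i A i !=set0.
  move=> Hw; have w0 := mass_gt0 w ord0 (Hw ord0).
  exists (pos_point w) => i _; apply: hsub; first exact: pos_point_simplex.
  by have := Hw i; rewrite /H /homogeneous_extension pmulr_rgt0.
have H0 i w : 0 <= H i w.
  have := pos_mass_ge0 w; rewrite le_eqVlt => /orP[/eqP w0|w0].
    by rewrite /H /homogeneous_extension -w0 mul0r.
  have /andP[? _] := a01 i _ (pos_point_simplex w0).
  by rewrite mulr_ge0 // ltW.
have Hmass w : \sum_i H i w = pos_mass w.
  have := pos_mass_ge0 w; rewrite le_eqVlt => /orP[/eqP w0|w0].
    by rewrite -w0 big1 // => i _; rewrite /H /homogeneous_extension -w0 mul0r.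
  by rewrite -mulr_sumr a1 ?mulr1 //; exact: pos_point_simplex.
case: (ltgtP (G ord_max z) 0) => Gz0.
- right; apply: (common (- z)) => i.
  by have := H0 i z; have := Gz i; move: Gz0; rewrite /G; lra.
- right; apply: (common z) => i.
  by have := H0 i (- z); have := Gz i; move: Gz0; rewrite /G; lra.
left.
have HE i : H i z = H i (- z).
  by apply/eqP; rewrite -subr_eq0 -[_ - _]/(G i z) Gz Gz0.
have mE : pos_mass z = pos_mass (- z) by rewrite -!Hmass; apply: eq_bigr => i _.
have m0 : 0 < pos_mass z by have := pos_massD z; rewrite -mE z1; lra.
have m0' : 0 < pos_mass (- z) by rewrite -mE.
exists [set i | 0 < z ord0 i]%SET, (~: [set i | (0 < z ord0 i)%R])%SET; split.
- exact: finset.setUCr.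
- by rewrite -finset.setI_eq0 finset.setICr.
exists (tuple_map alpha (pos_point z)); split.
  exists (pos_point z) => //; apply: pos_point_face => // i.
  by rewrite inE -leNgt.
exists (pos_point (- z)).
  by apply: pos_point_face => // i; rewrite !inE negbK mxE oppr_le0 => /ltW.
apply/rowP => i; rewrite !mxE.
by have := HE i; rewrite /H /homogeneous_extension -mE
  => /(mulfI (lt0r_neq0 m0)) ->.
Qed.
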